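(* Let $\mathcal{A}$ be a Tauberian algebra satisfying condition $(M)$, let $\mathcal{B}$ be a semisimple regular commutative Banach algebra, and let $T:\mathcal{A}\to\mathcal{B}$ be a bijective separating linear map. Then $\Omega_{\mathcal{B}}''=\Omega_{\mathcal{B}}$, $T$ is continuous, and $T^{-1}$ is a separating map. If, moreover, $\mathcal{B}$ is also a regular Tauberian algebra satisfying condition $(M)$, then the support map $t$ of $T$ is a homeomorphism from $\Omega_{\mathcal{B}}$ onto $\Omega_{\mathcal{A}}$, $X$ is a non-vanishing continuous map on $\Omega_{\mathcal{B}}$, and $\widehat{Ta}(y)=X(y)\,\widehat{a}(t(y))$ for all $a\in\mathcal{A}$ and $y\in\Omega_{\mathcal{B}}$.
   Context: For a commutative Banach algebra $\mathcal{A}$ (over $\mathbb{C}$), $\Omega_{\mathcal{A}}$ is its maximal ideal (character) space with the Gelfand topology, $\widehat{a}$ is the Gelfand transform of $a$, $\operatorname{coz}(\widehat a)=\{x\in\Omega_{\mathcal A}:\widehat a(x)\ne0\}$, and $\operatorname{supp}(\widehat a)$ is its closure. $\mathcal{A}$ is semisimple if $\bigcap_{x\in\Omega_{\mathcal A}}\ker x=\{0\}$. $\mathcal{A}$ is regular if for every $x\in\Omega_{\mathcal A}$ and open neighbourhood $U$ of $x$ there is $a\in\mathcal A$ with $\widehat a(x)=1$ and $\widehat a=0$ on $\Omega_{\mathcal A}\setminus U$. $\mathcal A_c$ is the set of $a\in\mathcal A$ with $\operatorname{supp}(\widehat a)$ compact. A Tauberian algebra is a semisimple commutative Banach algebra $\mathcal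 A$ in which $\mathcal A_c$ is dense. Condition $(M)$: $\mathcal A$ is regular and for each $x\in\Omega_{\mathcal A}$, each $a\in\mathcal A$ with $\widehat a(x)=0$, and each neighbourhood $U$ of $x$, $\inf\{\|ba\|_{\mathcal A}: b\in\mathcal A,\ \widehat b|_V\equiv1 \text{ for some neighbourhood } V \text{ of } x,\ \operatorname{supp}(\widehat b)\subseteq U\}=0$. A linear map $T:\mathcal A\to\mathcal B$ is separating if $a_1a_2=0$ implies $Ta_1\,Ta_2=0$ for all $a_1,a_2\in\mathcal A$. Let $T:\mathcal A\to\mathcal B$ be separating, with $\mathcal A,\mathcal B$ semisimple regular commutative. $\overline{\Omega}_{\mathcal A}$ is the one-point compactification of $\Omega_{\mathcal A}$. $\Omega_{\mathcal B}'$ is the set of $y\in\Omega_{\mathcal B}$ for which some $a\in\mathcal A$ has $\widehat{Ta}(y)\neq0$. For $y\in\Omega_{\mathcal B}'$ let $\tau_y:\mathcal A\to\mathbb C$, $\tau_y(a)=\widehat{Ta}(y)$. An open $V\subseteq\overline{\Omega}_{\mathcal A}$ is a vanishing set for $\tau_y$ if $\tau_y(a)=0$ for all $a\in\mathcal A$ with $\operatorname{coz}(\widehat a)\subseteq V$. It is known that $\operatorname{supp}(\tau_y):=\overline{\Omega}_{\mathcal A}\setminus\bigcup\{V: V\text{ a vanishing set for }\tau_y\}$ is a singleton; the support map $t:\Omega_{\mathcal B}'\to\overline{\Omega}_{\mathcal A}$ sends $y$ to its unique element. The function $X:t^{-1}(\Omega_{\mathcal A})\to\mathbb C$ is defined by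 $X(y)=\widehat{Ta_U}(y)$, where $U$ is any relatively compact neighbourhood of $t(y)$ and $a_U\in\mathcal A_c$ satisfies $\widehat{a}_U|_U\equiv1$ (this does not depend on the choices). $\Omega_{\mathcal B}''$ is the set of $y\in\Omega_{\mathcal B}'$ for which $\tau_y$ is continuous when $\mathcal A$ is given the norm $\|a\|_\infty=\sup_{x\in\Omega_{\mathcal A}}|\widehat a(x)|$. *)

(* Defs.v *)
From HB Require Import structures.
From mathcomp Require Import all_boot all_order all_algebra complex.
From mathcomp Require Import all_classical all_reals all_analysis.

Set Implicit Arguments.
Unset Strict Implicit.
Unset Printing Implicit Defensive.

Import Order.TTheory GRing.Theory Num.Theory.
Import numFieldNormedType.Exports.

Local Open Scope classical_set_scope.
Local Open Scope ring_scope.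
Local Open Scope complex_scope.

(* Banach algebras are not assumed unital, so the product is the (group_scope)
   product of a semigroup rather than that of a ring. *)
HB.mixin Record CompleteNormedModule_isCommBanachAlgebra (R : realType) A
    & CompleteNormedModule R[i] A & Semigroup A := {
  bmulC : forall a b : A, (a * b)%g = (b * a)%g;
  bmulDl : forall a b c : A, ((a + b) * c)%g = (a * c)%g + (b * c)%g;
  bscalerAl : forall (k : R[i]) (a b : A),
    k *: (a * b)%g = ((k *: a) * b)%g;
  bnormM : forall a b : A, `|(a * b)%g| <= `|a| * `|b| }.

#[short(type="commBanachAlgType")]
HB.structure Definition CommBanachAlgebra (R : realType) :=
  {A of CompleteNormedModule R[i] A & Semigroup A
      & CompleteNormedModule_isCommBanachAlgebra R A}.

(* Norms on R[i]-modules take values in R[i]; this is the real-valued norm. *)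
Definition rnorm (R : realType) (V : normedModType R[i]) (v : V) : R :=
  complex.Re `|v|.

Section Gelfand.
Context {R : realType} (A : commBanachAlgType R).

Definition characters : set {ptws A -> R[i]^o} :=
  [set f | [/\ forall (k : R[i]) (a b : A), f (k *: a + b) = k * f a + f b,
               forall a b : A, f (a * b)%g = f a * f b
             & exists a, f a != 0]].

(* The subspace topology of pointwise convergence is the Gelfand topology. *)
Definition Omega : topologicalType := set_type characters.

Definition gelfand (a : A) (x : Omega) : R[i] := set_val x a.

Definition coz (a : A) : set Omega := [set x | gelfand a x != 0].

Definition gsupp (a : A) : set Omega := closure (coz a).

Definition compactly_supported : set A := [set a | compact (gsupp a)].

Definition semisimple : Prop :=
  \bigcap_(x in [set: Omega]) [set a : A | gelfand a x = 0] = [set 0].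

Definition regular_algebra : Prop :=
  forall (x : Omega) (U : set Omega), open U -> U x ->
  exists a : A, gelfand a x = 1 /\ forall z, ~ U z -> gelfand a z = 0.

Definition tauberian : Prop := semisimple /\ dense compactly_supported.

Definition units_near (x : Omega) (U : set Omega) : set A :=
  [set b | (exists2 V, nbhs x V & forall z, V z -> gelfand b z = 1) /\
           gsupp b `<=` U].

Definition condition_M : Prop :=
  regular_algebra /\
  forall (x : Omega) (a : A) (U : set Omega), gelfand a x = 0 -> nbhs x U ->
  ereal_inf [set (rnorm (b * a)%g)%:E | b in units_near x U] = 0%E.

(* Gelfand transforms are bounded, so this supremum is finite. *)
Definition supnorm (a : A) : R :=
  sup [set rnorm (gelfand a x : R[i]^o) | x in [set: Omega]].

Definition supnorm_continuous (f : A -> R[i]) : Prop :=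
  forall (a : A) (e : R), 0 < e ->
  exists2 d : R, 0 < d & forall b : A,
    supnorm (b - a) < d -> rnorm (f b - f a : R[i]^o) < e.

End Gelfand.

Definition separating (R : realType) (A B : commBanachAlgType R)
    (T : {linear A -> B}) : Prop :=
  forall a1 a2 : A, (a1 * a2)%g = 0 -> (T a1 * T a2)%g = 0.

Definition homeomorphism (X Y : topologicalType) (f : X -> Y) : Prop :=
  continuous f /\ exists g : Y -> X, [/\ cancel f g, cancel g f & continuous g].

Section SupportMap.
Context {R : realType} {A B : commBanachAlgType R} (T : {linear A -> B}).

Definition tau (y : Omega B) (a : A) : R[i] := gelfand (T a) y.

Definition Omega' : set (Omega B) := [set y | exists a, tau y a != 0].

Definition Omega'' : set (Omega B) :=
  [set y | Omega' y /\ supnorm_continuous (tau y)].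

Definition vanishing_set (y : Omega B)
    (V : set (one_point_compactification (Omega A))) : Prop :=
  open V /\ forall a : A, Some @` coz a `<=` V -> tau y a = 0.

Definition tau_supp (y : Omega B) :
    set (one_point_compactification (Omega A)) :=
  ~` \bigcup_(V in vanishing_set y) V.

(* When T is separating and y lies in Omega', [tau_supp y] is a singleton;
   the default value None only matters outside Omega'. *)
Definition support_map (y : Omega B) : one_point_compactification (Omega A) :=
  xget (None : one_point_compactification (Omega A)) (tau_supp y).

Definition local_units (x : Omega A) : set A :=
  [set a | compactly_supported a /\
    exists U, [/\ nbhs x U, precompact U & forall z, U z -> gelfand a z = 1]].

(* The value at y of the transform of [T a] is the same for all local units a
   at the support point of y; the default 0 is taken only when that point is
   at infinity. *)
Definition support_weight (y : Omega B) : R[i] :=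
  if support_map y is Some x
  then xget 0 [set gelfand (T a) y | a in local_units x] else 0.

End SupportMap.

(* Main.v *)
Require Import Defs.
From HB Require Import structures.
From mathcomp Require Import all_boot all_order all_algebra complex.
From mathcomp Require Import all_classical all_reals all_analysis.
From mathcomp Require Import ring lra.
Import numFieldNormedType.Exports.
Import Order.TTheory GRing.Theory Num.Theory.

(** A character [y] of [B] turns [T] into the linear functional
    [a |-> gelfand (T a) y] on [A], the coordinate of [T] at [y]; it is
    separating in the sense that it kills one factor of every vanishing
    product.  The heart of the matter is that each coordinate is a nonzero
    multiple of a character of [A]; once this is known, everything in the
    theorem is a short computation with [gelfand (T a) y = w y * gelfand a (t y)].

    Every separating functional [f] has a support: either there is a point [x]
    such that [f] kills all elements whose transform vanishes near [x], or [f]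
    kills all elements of compact support
    ([separating_functional_support]).  The elements killed are dense in the
    kernel of the character [x], by condition (M), respectively in [A], by the
    Tauberian property.  Hence a bounded nonzero coordinate is a multiple of
    the character at its support point
    ([bounded_coordinate_weighted]), and what remains is automatic continuity:
    all coordinates are bounded.

    A gliding hump shows that the support points in [Omega A] of unbounded
    coordinates form a finite set [F] ([finite_unbounded_supports]): with
    infinitely many one could sum small elements with disjoint supports, each
    of them large for its own coordinate, contradicting
    [|gelfand (T a) y| <= 2 * |T a|].  By uniform boundedness the characters
    with unbounded coordinate form an open subset of [Omega B].  If [y] is one
    of them, regularity of [B] and surjectivity of [T] give [a] whose image
    has transform 1 at [y] and 0 at all characters with bounded coordinate.
    If the transform of [a] were nonzero outside [F], one could multiply [a] by
    some [c] of compact support, vanishing near [F], with [c * a <> 0]; but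
    every coordinate kills [c * a], either through its support or because it is
    a weighted evaluation that kills [a], and [T] is injective.  So the
    transform of [a] lives on the finite set [F], whose points where it is
    nonzero are isolated; at an isolated point being supported there already
    forces a functional to be a multiple of the character, hence bounded,
    contrary to the definition of [F] ([coordinates_bounded]).

    Boundedness of [T] itself follows from the closed graph theorem, and
    [T^-1] is separating because [w] has no zero and [T] is injective.  In the
    second part the same representation holds for [T^-1], with
    maps [s] and [v]; comparing the two, [s] and [t] are mutually inverse, and
    regularity gives the continuity of both.

    The analytic input, closed graph and uniform boundedness for norms with
    values in [R[i]], comes from one lemma in the style of Zabreiko: a
    countably subadditive seminorm on a Banach space is bounded
    ([countably_subadditive_seminorm_bounded]). *)

Set Implicit Arguments.
Unset Strict Implicit.
Unset Printing Implicit Defensive.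

Local Open Scope classical_set_scope.
Local Open Scope ring_scope.
Local Open Scope complex_scope.

(** * Real-valued norms and convergence *)

Section RealNorm.
Context {R : realType} {V : normedModType R[i]}.
Implicit Types v w : V.

Lemma rnormE v : `|v| = (rnorm v)%:C.
Proof. by rewrite /rnorm [RHS]RRe_real// ger0_real. Qed.

Lemma rnorm_ge0 v : 0 <= rnorm v.
Proof. rewrite -lecR -rnormE; exact: normr_ge0. Qed.

Lemma rnorm0 : rnorm (0 : V) = 0.
Proof. by rewrite /rnorm normr0. Qed.

Lemma rnorm_eq0 v : rnorm v = 0 -> v = 0.
Proof. by move=> v0; apply/eqP; rewrite -normr_eq0 rnormE v0. Qed.

Lemma rnormN v : rnorm (- v) = rnorm v.
Proof. by rewrite /rnorm normrN. Qed.

Lemma rnormB v w : rnorm (v - w) = rnorm (w - v).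
Proof. by rewrite -rnormN opprB. Qed.

Lemma rnormD v w : rnorm (v + w) <= rnorm v + rnorm w.
Proof. rewrite -lecR (rmorphD (real_complex R)) /= -!rnormE; exact: ler_normD. Qed.

Lemma rnorm_triangle v w u : rnorm (v - u) <= rnorm (v - w) + rnorm (w - u).
Proof. by apply: le_trans (rnormD _ _); rewrite addrA subrK. Qed.

Lemma rnormZ (k : R[i]) v : rnorm (k *: v) = rnorm (k : R[i]^o) * rnorm v.
Proof. by apply: complexI; rewrite (rmorphM (real_complex R)) /= -!rnormE normrZ. Qed.

Lemma rnorm_ballP v (U : set V) :
  nbhs v U <-> exists2 e : R, 0 < e & forall w, rnorm (w - v) < e -> U w.
Proof.
split=> [/nbhs_ballP[e /= e0 eU]|[e e0 eU]].
  have eR : (complex.Re e)%:C = e by rewrite RRe_real// ger0_real// ltW.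
  exists (complex.Re e); first by rewrite -ltcR eR.
  move=> w; rewrite rnormB -ltcR eR -rnormE => vw.
  by apply: eU; rewrite -ball_normE.
apply/nbhs_ballP; exists e%:C; first by rewrite /= ltcR.
move=> w; rewrite -ball_normE /= rnormE ltcR rnormB; exact: eU.
Qed.

Lemma rnorm_eps_le0 v : (forall e : R, 0 < e -> rnorm v <= e) -> v = 0.
Proof.
move=> ve; apply: rnorm_eq0; apply/le_anti; rewrite rnorm_ge0 andbT.
by apply/ler_addgt0Pr => e /ve; rewrite add0r.
Qed.

End RealNorm.

Notation cmod z := (rnorm (z : _ [i]^o)).

Lemma cmodM (R : realType) (z w : R[i]) : cmod (z * w) = cmod z * cmod w.
Proof. exact: (@rnormZ R R[i]^o). Qed.

Section Series.
Context {R : realType} {V : completeNormedModType R[i]}.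

Lemma half_pow_small (e : R) : 0 < e -> exists n, (2 : R) ^- n < e.
Proof.
move=> e0; exists (Num.trunc e^-1).+1.
rewrite -[ltRHS]invrK ltf_pV2 ?posrE ?invr_gt0 ?exprn_gt0//.
apply: (lt_trans (truncnS_gt _)); rewrite -natrX ltr_nat.
exact: ltn_expl.
Qed.

(** Completeness with an explicit rate, which survives in the limit; all
    limits below are taken through this lemma. *)
Lemma rnorm_complete (w : nat -> V) (r : nat -> R) :
  (forall n m, (n <= m)%N -> rnorm (w m - w n) <= r n) ->
  (forall e, 0 < e -> exists n, r n < e) ->
  exists s, forall n, rnorm (s - w n) <= r n.
Proof.
move=> wr rsmall.
have : cvg (w @ \oo).
  apply/cauchy_cvgP; apply: cauchy_exP => e e0.
  have eR : (complex.Re e)%:C = e by rewrite RRe_real// ger0_real// ltW.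
  have [|n ne] := rsmall (complex.Re e); first by rewrite -ltcR eR.
  exists (w n); exists n => // m /= nm.
  rewrite -ball_normE /= rnormE -eR ltcR rnormB.
  exact: le_lt_trans (wr _ _ nm) ne.
move=> /cvg_ex[l wl]; exists l => n.
apply/ler_addgt0Pr => e e0.
have /wl [N _ Nl] : nbhs l [set v | rnorm (v - l) < e].
  by apply/rnorm_ballP; exists e.
have := Nl (maxn N n) (leq_maxl _ _); rewrite /= rnormB.
have := wr n (maxn N n) (leq_maxr _ _).
have := rnorm_triangle l (w (maxn N n)) (w n); lra.
Qed.

(** Ratio 1/2 suffices for all series needed here: the Neumann series, the
    gliding hump and the successive approximations behind the closed graph
    theorem. *)
Lemma geometric_series (v : nat -> V) (C : R) :
  (forall n, rnorm (v n) <= C * 2 ^- n) ->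
  exists s, forall n, rnorm (s - \sum_(k < n) v k) <= 2 * C * 2 ^- n.
Proof.
move=> vC; apply: rnorm_complete => [n m nm|e e0].
  have C0 : 0 <= C.
    by have := le_trans (rnorm_ge0 _) (vC 0%N); rewrite expr0 invr1 mulr1.
  (* the geometric tail, kept exact so that the induction closes *)
  have tail d : rnorm (\sum_(k < n + d) v k - \sum_(k < n) v k) <=
      2 * C * (2 ^- n - 2 ^- (n + d)).
    elim: d => [|d IH]; first by rewrite addn0 !subrr rnorm0 mulr0.
    rewrite addnS big_ord_recr /= addrAC.
    apply: le_trans (rnormD _ _) _.
    by have := vC (n + d)%N; rewrite exprS invfM; lra.
  have := tail (m - n)%N; rewrite subnKC// mulrBr.
  have : 0 <= 2 * C * 2 ^- m by rewrite !mulr_ge0// invr_ge0 exprn_ge0.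
  by lra.
have CN : 0 < `|2 * C| + 1 by rewrite ltr_wpDl.
have [|n ne] := @half_pow_small (e / (`|2 * C| + 1)); first by rewrite divr_gt0.
exists n; rewrite ltr_pdivlMr// in ne.
have : (0 : R) < 2 ^- n by rewrite invr_gt0 exprn_gt0.
by have := ler_norm (2 * C); nra.
Qed.

End Series.

(** * Baire category, seminorms, bounded operators *)

Section Baire.
Context {R : realType} {V : completeNormedModType R[i]}.

(** If no [E n] were dense in a ball, one could nest balls so that the [n]-th
    one misses [E n] and the radii at least halve; their common point would lie
    in no [E n]. *)
Lemma baire_dense_in_ball (E : nat -> set V) : (forall v, exists n, E n v) ->
  exists n v, exists2 r : R, 0 < r &
    forall w e, rnorm (w - v) < r -> 0 < e ->
      exists2 u, rnorm (u - w) < e & E n u.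
Proof.
move=> Ecov; apply: contrapT => nE.
(* a state is a stage together with a ball, given by its centre and radius *)
pose step (s t : nat * (V * {posnum R})) :=
  [/\ t.1 = s.1.+1, rnorm (t.2.1 - s.2.1) <= s.2.2%:num / 4,
      t.2.2%:num <= s.2.2%:num / 2
    & forall u, rnorm (u - t.2.1) < t.2.2%:num -> ~ E s.1 u].
have stepP s : {t | step s t}.
  apply: cid; case: s => n [v r].
  have : ~ forall w e, rnorm (w - v) < r%:num / 4 -> 0 < e ->
      exists2 u, rnorm (u - w) < e & E n u.
    by move=> H; apply: nE; exists n, v, (r%:num / 4).
  move=> /existsNP[w] /existsNP[e] /not_implyP[wv] /not_implyP[e0] noE.
  have d0 : 0 < Num.min e (r%:num / 2) by rewrite lt_min e0 divr_gt0.
  exists (n.+1, (w, PosNum d0)); split => //=.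
  - exact: ltW.
  - by rewrite ge_min lexx orbT.
  - by move=> u; rewrite lt_min => /andP[uw _] Eu; apply: noE; exists u.
have [f [f0 fS]] := dependent_choice stepP (0%N, (0, PosNum ltr01)).
pose w n := (f n).2.1; pose r n := (f n).2.2%:num.
have r_gt0 n : 0 < r n by rewrite /r.
have fn n : (f n).1 = n.
  by elim: n => [|n IH]; rewrite ?f0//; have [-> _ _ _] := fS n; rewrite IH.
have wr n d : rnorm (w (n + d)%N - w n) <= (r n - r (n + d)%N) / 2.
  elim: d => [|d IH]; first by rewrite addn0 !subrr rnorm0 mul0r.
  rewrite addnS; have [_ + + _] := fS (n + d)%N.
  rewrite -/(w _) -/(w _) -/(r _) -/(r _).
  have := rnorm_triangle (w (n + d).+1) (w (n + d)%N) (w n); lra.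
have [s sw] : exists s, forall n, rnorm (s - w n) <= r n / 2.
  apply: rnorm_complete => [n m nm|e e0].
    have := wr n (m - n)%N; rewrite subnKC//.
    have := r_gt0 m; lra.
  have [n ne] := half_pow_small e0; exists n; apply: le_lt_trans ne.
  have : r n <= 2 ^- n.
    elim: n => [|n IH]; first by rewrite /r f0 /= expr0 invr1.
    have [_ _ + _] := fS n; rewrite -/(r _) -/(r _) exprS invfM; lra.
  have := r_gt0 n; lra.
have [n] := Ecov s; have [_ _ _] := fS n; rewrite fn; apply.
have := r_gt0 n.+1.
by have := sw n.+1; rewrite -/(w _) -/(r _); lra.
Qed.

End Baire.

Section Zabreiko.
Context {R : realType} {V : completeNormedModType R[i]}.

(** By Baire, some sublevel set of [p] is dense in a ball; by subadditivity and
    homogeneity every [v] is then approximated arbitrarily well by elements on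
    which [p] is at most a constant times the norm of [v].  Iterating on the
    remainder writes [v] as a series to which countable subadditivity applies.
    Both the closed graph theorem ([p] is the norm of [T v]) and the uniform
    boundedness principle ([p] is a supremum of norms) are instances. *)
Lemma countably_subadditive_seminorm_bounded (p : V -> R) :
  (forall v w, p (v + w) <= p v + p w) ->
  (forall (k : R[i]) v, p (k *: v) <= cmod k * p v) ->
  (forall (v : nat -> V) (C D : R) (s : V), (forall n, p (v n) <= C * 2 ^- n) ->
     (forall n, rnorm (s - \sum_(k < n) v k) <= D * 2 ^- n) -> p s <= 2 * C) ->
  exists2 M : R, 0 < M & forall v, p v <= M * rnorm v.
Proof.
move=> pD pZ psum.
have [|n [v0 [r r0 dense_r]]] :=
    @baire_dense_in_ball R V (fun n => [set v | p v <= n%:R]).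
  move=> v; exists (Num.trunc (p v)).+1 => /=; apply/ltW; exact: truncnS_gt.
have cmodR (t : R) : 0 <= t -> cmod t%:C = t.
  by move=> t0; apply: complexI; rewrite -rnormE ger0_norm// lecR.
have pN v : p (- v) <= p v.
  have : cmod (-1 : R[i]) = 1 by rewrite rnormN; exact: (cmodR 1 ler01).
  by have := pZ (-1) v; rewrite scaleN1r => /[swap] ->; rewrite mul1r.
have p0 : p 0 <= 0.
  by have := pZ 0 0; rewrite scale0r (_ : cmod 0 = 0) ?rnorm0// mul0r.
have unit_approx v (e : R) : rnorm v < r -> 0 < e ->
    exists2 u, rnorm (v - u) < e & p u <= 2 * n%:R.
  move=> vr e0; have e20 : 0 < e / 2 by lra.
  have [|u1 /= u1v pu1] := dense_r (v0 + v) (e / 2) _ e20.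
    by rewrite addrC addKr.
  have [|u2 /= u2v pu2] := dense_r v0 (e / 2) _ e20; first by rewrite subrr rnorm0.
  exists (u1 - u2).
    have -> : v - (u1 - u2) = (u2 - v0) - (u1 - (v0 + v)).
      by rewrite !opprB !addrA subrK [v + u2]addrC.
    by have := rnormD (u2 - v0) (- (u1 - (v0 + v))); rewrite rnormN; lra.
  by have := pD u1 (- u2); have := pN u2; lra.
have approx v (t e : R) : 0 < t -> rnorm v < r * t -> 0 < e ->
    exists2 u, rnorm (v - u) < e & p u <= 2 * n%:R * t.
  move=> t0 vr e0.
  have tN0 : t%:C != 0 by rewrite lt0r_neq0// ltcR.
  have [||u ue pu] := @unit_approx (t%:C^-1 *: v) (e / t).
  - have : cmod (t%:C) * rnorm (t%:C^-1 *: v) = rnorm v.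
      by rewrite -rnormZ scalerA mulfV// scale1r.
    by rewrite (cmodR _ (ltW t0)) => vE; rewrite -vE mulrC ltr_pM2r in vr.
  - exact: divr_gt0.
  exists (t%:C *: u).
    rewrite (_ : v - _ = t%:C *: (t%:C^-1 *: v - u)).
      by rewrite rnormZ (cmodR _ (ltW t0)) mulrC -ltr_pdivlMr.
    by rewrite scalerBr scalerA mulfV// scale1r.
  apply: le_trans (pZ _ _) _; rewrite (cmodR _ (ltW t0)).
  by rewrite [leRHS]mulrC; apply: ler_wpM2l pu; exact: ltW.
exists (8 * n%:R / r + 1) => [|v].
  by rewrite ltr_wpDl// divr_ge0 ?mulr_ge0// ltW.
have [v00|vN0] := eqVneq (rnorm v) 0.
  by rewrite v00 mulr0 (rnorm_eq0 v00).
have v_gt0 : 0 < rnorm v by rewrite lt_def vN0 rnorm_ge0.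
pose rho k := rnorm v * 2 ^- k.
have rho_gt0 k : 0 < rho k by rewrite mulr_gt0// invr_gt0 exprn_gt0.
(* [good (k, w) u]: the next term [u] of the series, given the remainder [w]
   left after [k] steps; the guard makes the choice total *)
pose good (s : nat * V) u := rnorm s.2 <= rho s.1 ->
  rnorm (s.2 - u) <= rho s.1.+1 /\ p u <= 2 * n%:R * (2 * rho s.1 / r).
have /boolp.choice[g gP] s : exists u, good s u.
  case: s => k w; rewrite /good /=.
  have [wk|wk] := leP (rnorm w) (rho k); last by exists 0.
  have [|||u uw pu] := @approx w (2 * rho k / r) (rho k.+1).
  - by rewrite divr_gt0// mulr_gt0.
  - by rewrite mulrCA mulfV ?lt0r_neq0// mulr1; have := rho_gt0 k; lra.
  - exact: rho_gt0.
  by exists u; split => //; exact: ltW.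
pose fix w k := if k is k'.+1 then w k' - g (k', w k') else v.
have wrho k : rnorm (w k) <= rho k.
  elim: k => [|k IH]; first by rewrite /rho expr0 invr1 mulr1.
  by have [] := gP (k, w k) IH.
have pg k : p (g (k, w k)) <= 4 * n%:R * rnorm v / r * 2 ^- k.
  have [_] := gP (k, w k) (wrho k); rewrite /= /rho => /le_trans; apply.
  rewrite le_eqVlt; apply/orP; left; apply/eqP; field.
  by rewrite expf_neq0 ?lt0r_neq0.
have wE k : v - \sum_(j < k) g (nat_of_ord j, w j) = w k.
  elim: k => [|k IH]; first by rewrite big_ord0 subr0.
  by rewrite big_ord_recr/= opprD addrA IH.
apply: le_trans (psum (fun k => g (k, w k)) _ (rnorm v) v pg _) _ => [k|].
  by rewrite wE.
suff -> : 2 * (4 * n%:R * rnorm v / r) = 8 * n%:R / r * rnorm v.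
  by rewrite [X in _ <= X]mulrDl [1 * _]mul1r lerDl rnorm_ge0.
by field; exact: lt0r_neq0.
Qed.

End Zabreiko.

Section Boundedness.
Context {R : realType} {V : completeNormedModType R[i]}.

(** For linear [T] this is closedness of the graph: the limits of [T a] along
    [a] tending to 0 form a subspace, required to be trivial. *)
Definition closed_graph_at0 (W : normedModType R[i]) (T : V -> W) :=
  forall b, (forall e : R, 0 < e -> exists2 a, rnorm a < e & rnorm (T a - b) < e) ->
    b = 0.

(** The images of the terms have a sum in [W], which can only be [T s].  This is
    the countable subadditivity of the norm of [T v]. *)
Lemma closed_graph_series (W : completeNormedModType R[i]) (T : {linear V -> W})
    (v : nat -> V) (C D : R) (s : V) :
  closed_graph_at0 T -> (forall n, rnorm (T (v n)) <= C * 2 ^- n) ->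
  (forall n, rnorm (s - \sum_(k < n) v k) <= D * 2 ^- n) -> rnorm (T s) <= 2 * C.
Proof.
move=> graphT /geometric_series[b bT] sv.
suff -> : T s = b.
  by have := bT 0%N; rewrite big_ord0 subr0 expr0 invr1 mulr1.
apply/eqP; rewrite -subr_eq0; apply/eqP/graphT => e e0.
have [|n ne] := @half_pow_small R (e / (`|D| + `|2 * C| + 1)).
  by rewrite divr_gt0// ltr_wpDl// addr_ge0.
rewrite ltr_pdivlMr ?ltr_wpDl ?addr_ge0// in ne.
have pn : 0 < (2 : R) ^- n by rewrite invr_gt0 exprn_gt0.
have := ler_norm D; have := ler_norm (2 * C).
have := normr_ge0 D; have := normr_ge0 (2 * C) => ? ? ? ?.
exists (s - \sum_(k < n) v k); first by have := sv n; nra.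
rewrite linearB linear_sum /= opprB addrC addrA subrK.
by have := bT n; nra.
Qed.

Lemma closed_graph (W : completeNormedModType R[i]) (T : {linear V -> W}) :
  closed_graph_at0 T -> exists2 M : R, 0 < M & forall v, rnorm (T v) <= M * rnorm v.
Proof.
move=> graphT.
apply: (@countably_subadditive_seminorm_bounded R V (fun v => rnorm (T v))).
- by move=> v w; rewrite linearD; exact: rnormD.
- by move=> k v; rewrite linearZ rnormZ.
- by move=> v C D s; exact: closed_graph_series.
Qed.

(** A convenient way to prove that a vector is 0: approximate it by values of a
    bounded map at small arguments. *)
Lemma bounded_closed_graph (W : normedModType R[i]) (T : V -> W) (M : R) :
  (forall v, rnorm (T v) <= M * rnorm v) -> closed_graph_at0 T.
Proof.
move=> TM b bT; apply: rnorm_eps_le0 => e e0.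
have M1 : 0 < `|M| + 1 by rewrite ltr_wpDl.
have [d d0 dE] : exists2 d, 0 < d & d * (`|M| + 1) = e.
  by exists (e / (`|M| + 1)); rewrite ?divr_gt0// divfK ?lt0r_neq0.
have [a ad Tab] := bT d d0.
have := rnormD (T a) (- (T a - b)); rewrite rnormN opprB addrC subrK.
have : M * rnorm a <= `|M| * d.
  apply: (@le_trans _ _ (`|M| * rnorm a)).
    by rewrite ler_wpM2r ?rnorm_ge0 ?ler_norm.
  by rewrite ler_wpM2l// ltW.
have := TM a; lra.
Qed.

(** The analogue of [closed_graph_series] for a bounded map, where completeness
    of [W] is replaced by continuity. *)
Lemma bounded_series (W : normedModType R[i]) (T : {linear V -> W})
    (v : nat -> V) (M C D : R) (s : V) :
  (forall v, rnorm (T v) <= M * rnorm v) -> (forall n, rnorm (T (v n)) <= C * 2 ^- n) ->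
  (forall n, rnorm (s - \sum_(k < n) v k) <= D * 2 ^- n) -> rnorm (T s) <= 2 * C.
Proof.
move=> TM TvC sv.
have sumC n : rnorm (T (\sum_(k < n) v k)) <= 2 * C * (1 - 2 ^- n).
  elim: n => [|n IH].
    by rewrite big_ord0 linear0 rnorm0 expr0 invr1 subrr mulr0.
  rewrite big_ord_recr linearD /=; apply: le_trans (rnormD _ _) _.
  by have := TvC n; rewrite exprS invfM; lra.
have C0 : 0 <= C.
  by have := le_trans (rnorm_ge0 _) (TvC 0%N); rewrite expr0 invr1 mulr1.
apply/ler_addgt0Pr => e e0.
have MD : 0 < `|M| * `|D| + 1 by rewrite ltr_wpDl// mulr_ge0.
have [|n ne] := @half_pow_small R (e / (`|M| * `|D| + 1)); first exact: divr_gt0.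
rewrite ltr_pdivlMr// in ne.
have pn : 0 < (2 : R) ^- n by rewrite invr_gt0 exprn_gt0.
have rest : M * rnorm (s - \sum_(k < n) v k) <= `|M| * (`|D| * 2 ^- n).
  apply: (@le_trans _ _ (`|M| * rnorm (s - \sum_(k < n) v k))).
    by rewrite ler_wpM2r ?rnorm_ge0 ?ler_norm.
  apply: ler_wpM2l => //; apply: le_trans (sv n) _.
  by rewrite ler_wpM2r ?ler_norm// ltW.
have := TM (s - \sum_(k < n) v k); have := sumC n.
have := rnormD (T (\sum_(k < n) v k)) (T (s - \sum_(k < n) v k)).
rewrite -linearD addrC subrK.
have : 0 <= 2 * C * 2 ^- n by rewrite !mulr_ge0// ltW.
lra.
Qed.

Lemma uniform_boundedness (W : normedModType R[i]) (I : Type) (D : set I)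
    (f : I -> {linear V -> W}) (q : V -> R) :
  (forall i, D i -> exists M, forall v, rnorm (f i v) <= M * rnorm v) ->
  (forall i v, D i -> rnorm (f i v) <= q v) ->
  exists2 M : R, 0 < M & forall i v, D i -> rnorm (f i v) <= M * rnorm v.
Proof.
move=> fbounded fq.
(* 0 is added because [D] may be empty *)
pose S v := [set 0] `|` [set rnorm (f i v) | i in D].
have Sub v : has_ubound (S v).
  exists (`|q v|) => _ [->|[i Di <-]]; first exact: normr_ge0.
  exact: le_trans (fq i v Di) (ler_norm _).
have S_ne v : S v !=set0 by exists 0; left.
have supS v i : D i -> rnorm (f i v) <= sup (S v).
  by move=> Di; apply: ub_le_sup (Sub v) _ _; right; exists i.
have supS0 v : 0 <= sup (S v) by apply: ub_le_sup (Sub v) _ _; left.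
have [|||M M0 SM] := @countably_subadditive_seminorm_bounded R V (fun v => sup (S v)).
- move=> v w; apply: ge_sup => // _ [->|[i Di <-]]; first exact: addr_ge0.
  rewrite linearD; apply: le_trans (rnormD _ _) _.
  by apply: lerD; exact: supS.
- move=> k v; apply: ge_sup => // _ [->|[i Di <-]].
    by apply: mulr_ge0 => //; exact: rnorm_ge0.
  rewrite linearZ rnormZ; apply: ler_wpM2l; first exact: rnorm_ge0.
  exact: supS.
- move=> v C E s vC sE; apply: ge_sup => // _ [->|[i Di <-]].
    have := le_trans (supS0 _) (vC 0%N); rewrite expr0 invr1 mulr1; lra.
  have [M fM] := fbounded i Di.
  by apply: bounded_series fM _ sE => n; exact: le_trans (supS _ _ Di) (vC n).
by exists M => // i v Di; exact: le_trans (supS _ _ Di) (SM v).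
Qed.

End Boundedness.

(** * Gelfand transforms *)

Section Evaluation.
Context {R : realType} {A : commBanachAlgType R}.
Implicit Types (a b : A) (x : Omega A).

(** The transform in its second argument: typing the values in the regular
    module [R[i]^o] makes each character available as a linear map. *)
Definition evaluation x : A -> R[i]^o := fun a => gelfand a x.

Lemma gelfand_character x : characters (set_val x).
Proof. by case: x => f; rewrite set_valE /= => /set_mem. Qed.

Lemma evaluation_linear x : linear (evaluation x).
Proof. by move=> k a b; have [fL _ _] := gelfand_character x; exact: fL. Qed.

HB.instance Definition _ x := GRing.isLinear.Build R[i] A R[i]^o _ (evaluation x)
  (evaluation_linear x).

Lemma gelfandM a b x : gelfand (a * b)%g x = gelfand a x * gelfand b x.
Proof. by have [_ fM _] := gelfand_character x; exact: fM. Qed.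

Lemma gelfandD a b x : gelfand (a + b) x = gelfand a x + gelfand b x.
Proof. exact: (linearD (evaluation x)). Qed.

Lemma gelfandB a b x : gelfand (a - b) x = gelfand a x - gelfand b x.
Proof. exact: (linearB (evaluation x)). Qed.

Lemma gelfandZ (k : R[i]) a x : gelfand (k *: a) x = k * gelfand a x.
Proof. by rewrite -[LHS]/(evaluation x (k *: a)) linearZ. Qed.

Lemma gelfand0 x : gelfand (0 : A) x = 0.
Proof. exact: (linear0 (evaluation x)). Qed.

Lemma gelfand_nontrivial x : exists a, gelfand a x != 0.
Proof. by have [_ _] := gelfand_character x. Qed.

Lemma rnormM a b : rnorm (a * b)%g <= rnorm a * rnorm b.
Proof.
rewrite -lecR (rmorphM (real_complex R)) /= -!rnormE; exact: bnormM.
Qed.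

(** If [s] is the sum of the powers of [a] then [s = a + a * s], and applying the
    character yields [gelfand s x = 1 + gelfand s x].  This is the Neumann
    series written without a unit. *)
Lemma character_no_small_unit x a : rnorm a <= 1 / 2 -> gelfand a x = 1 -> False.
Proof.
move=> a2 ax.
pose v n := iter n (fun b : A => (a * b)%g) a.
have v_small n : rnorm (v n) <= 1 * 2 ^- n.
  rewrite mul1r; elim: n => [|n IH]; first by rewrite expr0 invr1; lra.
  apply: le_trans (rnormM _ _) _; rewrite exprS invfM.
  by rewrite ler_pM ?rnorm_ge0//; lra.
have [s sv] := geometric_series v_small.
have sum_step n : \sum_(k < n.+1) v k = a + (a * \sum_(k < n) v k)%g.
  elim: n => [|n IH].
    rewrite big_ord_recl !big_ord0 addr0.
    have -> : (a * 0)%g = 0 :> A.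
      by apply: (addrI (a * 0)%g); rewrite bmulC -bmulDl addr0 addr0.
    by rewrite addr0.
  rewrite big_ord_recr /= {1}IH [in RHS]big_ord_recr /= -addrA; congr (_ + _).
  by rewrite ![(a * _)%g]bmulC bmulDl.
have sE : s = a + (a * s)%g.
  apply/eqP; rewrite -subr_eq0; apply/eqP/rnorm_eps_le0 => e e0.
  have [n ne] := @half_pow_small R (e / 4) ltac:(lra).
  have := sv n; have := sv n.+1; rewrite sum_step exprS invfM => sv1 sv0.
  have -> : s - (a + (a * s)%g) =
      (s - (a + (a * \sum_(k < n) v k)%g)) - (a * (s - \sum_(k < n) v k))%g.
    have -> : (a * (s - \sum_(k < n) v k))%g = (a * s)%g - (a * \sum_(k < n) v k)%g.
      by apply/eqP; rewrite eq_sym subr_eq ![(a * _)%g]bmulC -bmulDl subrK.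
    by rewrite opprB !opprD !addrA subrK.
  apply: le_trans (rnormD _ _) _; rewrite rnormN.
  have := rnormM a (s - \sum_(k < n) v k).
  have := rnorm_ge0 (s - \sum_(k < n) v k); have := rnorm_ge0 a.
  have : (0 : R) < 2 ^- n by rewrite invr_gt0 exprn_gt0.
  nra.
have : gelfand s x = 1 + gelfand s x by rewrite {1}sE gelfandD gelfandM ax mul1r.
by rewrite -{1}[gelfand s x]add0r => /addIr/eqP; rewrite eq_sym oner_eq0.
Qed.

(** The constant 2, rather than the optimal 1, comes from the ratio 1/2 of the
    series; any uniform constant serves. *)
Lemma gelfand_le_norm a x : cmod (gelfand a x) <= 2 * rnorm a.
Proof.
rewrite leNgt; apply/negP => lt_a.
have ax0 : 0 < cmod (gelfand a x).
  by apply: le_lt_trans lt_a; rewrite mulr_ge0 ?rnorm_ge0.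
have axN0 : gelfand a x != 0.
  by apply/eqP => ax; move: ax0; rewrite ax rnorm0 ltxx.
have := @character_no_small_unit x ((gelfand a x)^-1 *: a).
rewrite gelfandZ mulVf// => /(_ _ erefl); apply.
have := rnormZ (gelfand a x) ((gelfand a x)^-1 *: a).
rewrite scalerA mulfV// scale1r; have := rnorm_ge0 ((gelfand a x)^-1 *: a).
nra.
Qed.

Lemma gelfand_continuous a : continuous (gelfand a : Omega A -> R[i]^o).
Proof.
have proj_cont : continuous (proj a : {ptws A -> R[i]^o} -> R[i]^o).
  exact: (@proj_continuous A (fun=> R[i]^o) a).
move=> x; apply: (@continuous_comp (Omega A) {ptws A -> R[i]^o} R[i]^o set_val (proj a)).
  exact: initial_continuous.
exact: proj_cont.
Qed.

Lemma open_coz a : open (coz a).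
Proof.
rewrite (_ : coz a = (gelfand a : Omega A -> R[i]^o) @^-1` (~` [set 0])).
  have /continuousP := @gelfand_continuous a; apply; apply: closed_openC.
  apply: accessible_closed_set1; apply: hausdorff_accessible.
  exact: norm_hausdorff.
by apply/seteqP; split=> x /= /eqP.
Qed.

Lemma Omega_hausdorff : hausdorff_space (Omega A).
Proof.
move=> x y xy; apply: val_inj; apply/funext => a.
apply: (@norm_hausdorff _ R[i]^o) => U V Ux Vy.
pose g : Omega A -> R[i]^o := gelfand a.
by have [||z [zU zV]] := xy (g @^-1` U) (g @^-1` V);
  [exact: gelfand_continuous|exact: gelfand_continuous|exists (g z)].
Qed.

Lemma open_setC_finite (F : set (Omega A)) : finite_set F -> open (~` F).
Proof.
move=> Ffin; apply: closed_openC; move: F Ffin; apply/accessible_finite_set_closed.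
exact/hausdorff_accessible/Omega_hausdorff.
Qed.

Lemma separate_points x y : x <> y ->
  exists U V, [/\ open_nbhs x U, open_nbhs y V & U `&` V = set0].
Proof.
move=> xy; have := Omega_hausdorff; rewrite open_hausdorff => /(_ x y) [|[U V] /=].
  exact/eqP.
move=> [/set_mem Ux /set_mem Vy] [oU oV /eqP UV]; exists U, V; split => //; split => //.
Qed.

Lemma notin_gsupp a x : ~ gsupp a x -> gelfand a x = 0.
Proof.
by move=> ax; apply/eqP; apply: contrapT => /negP ax0; apply: ax; exact: subset_closure.
Qed.

Lemma open_setC_gsupp a : open (~` gsupp a).
Proof. by apply: closed_openC; exact: closed_closure. Qed.

Lemma vanish_near_notin_gsupp a x : ~ gsupp a x -> \forall z \near x, gelfand a z = 0.
Proof.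
move=> ax; apply: filterS (open_nbhs_nbhs (conj (@open_setC_gsupp a) ax)) => z.
exact: notin_gsupp.
Qed.

Lemma compactly_supported_sub a b : coz a `<=` gsupp b ->
  compactly_supported b -> compactly_supported a.
Proof.
move=> ab cb; apply: (subclosed_compact _ cb); first exact: closed_closure.
by rewrite /gsupp closureE; apply: smallest_sub => //; exact: closed_closure.
Qed.

Lemma semisimple_eq0 a : semisimple A -> (forall x, gelfand a x = 0) -> a = 0.
Proof.
by move=> ssA a0; have : [set 0] a by rewrite -ssA => x _; exact: a0.
Qed.

End Evaluation.

(** * Local units and separating functionals *)

(** Compactness for an ideal of sets: what holds locally and is stable under
    finite unions holds on a set containing [K]. *)
Lemma compact_ideal (X : topologicalType) (K : set X) (G : set (set X)) :
  G set0 -> (forall C D, G C -> G D -> G (C `|` D)) ->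
  (forall x, K x -> exists2 U, nbhs x U & G U) -> compact K ->
  exists2 C, G C & K `<=` C.
Proof.
move=> G0 GU Gnear /compact_near_coveringP cK.
pose above C := [set D : set X | G D /\ C `<=` D].
have above_filter : Filter (filter_from G above).
  apply: filter_from_filter; first by exists set0.
  move=> C D GC GD; exists (C `|` D); first exact: GU.
  by move=> E [GE CDE]; split; split => // z Cz; apply: CDE; [left|right].
have := cK _ (filter_from G above) (fun C x => C x) above_filter.
case=> [x Kx|C GC KC].
  have [U xU GU'] := Gnear x Kx.
  by exists (U, above U) => /=; [split => //; exists U|case=> z C [/= Uz [_]]; apply].
by exists C => //; apply: (KC C); split.
Qed.

Section Units.
Context {R : realType} {A : commBanachAlgType R}.
Implicit Types (a b u : A) (x : Omega A).

(** The infimum of condition (M), taken at the element 0, is that of a nonempty set,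
    since an empty one would give infinity. *)
Lemma local_unit x (U : set (Omega A)) : condition_M A -> nbhs x U ->
  exists u, units_near x U u.
Proof.
move=> [_ mA] xU; have infE := mA x 0 U (gelfand0 x) xU.
apply: contrapT => noU; move: infE.
rewrite (_ : [set _ | _ in _] = set0) ?ereal_inf0//.
by apply/seteqP; split => // y [u uU _]; apply: noU; exists u.
Qed.

Lemma units_near_at x U u : units_near x U u -> gelfand u x = 1.
Proof. by move=> [[V /nbhs_singleton Vx] /(_ x Vx)]. Qed.

Lemma units_near_germ x U u a : units_near x U u ->
  \forall z \near x, gelfand (a - (u * a)%g) z = 0.
Proof.
move=> [[V xV u1] _]; apply: filterS xV => z /u1 uz.
by rewrite gelfandB gelfandM uz mul1r subrr.
Qed.

Lemma coz_mull a b : coz (a * b)%g `<=` coz a.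
Proof. by move=> z; rewrite /coz /= gelfandM mulf_eq0 negb_or => /andP[]. Qed.

Lemma coz_sub_gsupp a : coz a `<=` gsupp a. Proof. exact: subset_closure. Qed.

Lemma dense_rnorm (D : set A) a (e : R) : dense D -> 0 < e ->
  exists2 b, D b & rnorm (b - a) < e.
Proof.
move=> dD e0; have /nbhs_interior ae : nbhs a [set b | rnorm (b - a) < e].
  by apply/rnorm_ballP; exists e.
have [||b [be Db]] := dD ([set b | rnorm (b - a) < e]°).
- by exists a; exact: nbhs_singleton ae.
- exact: open_interior.
- by exists b => //; exact: interior_subset be.
Qed.

(** Approximating an element that does not vanish at [x] shows that a Tauberian
    algebra has a locally compact character space. *)
Lemma compactly_supported_at x : tauberian A ->
  exists2 a, compactly_supported a & gelfand a x != 0.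
Proof.
move=> [_ dA]; have [a ax] := gelfand_nontrivial x.
have ax0 : 0 < cmod (gelfand a x).
  rewrite lt_def rnorm_ge0 andbT; apply: contra ax => /eqP ax.
  by rewrite (@rnorm_eq0 R R[i]^o _ ax).
have [b cb ba] := @dense_rnorm _ a (cmod (gelfand a x) / 2) dA ltac:(lra).
exists b => //; apply/eqP => bx.
have := gelfand_le_norm (b - a) x; rewrite gelfandB bx sub0r rnormN; lra.
Qed.

Lemma compactly_supported_unit x : tauberian A -> condition_M A ->
  exists2 u, compactly_supported u & units_near x [set: Omega A] u.
Proof.
move=> tA mA; have [a ca ax] := compactly_supported_at x tA.
have [u [ux ua]] := local_unit mA (open_nbhs_nbhs (conj (open_coz a) ax)).
exists u; last by split.
apply: compactly_supported_sub ca => z /coz_sub_gsupp/ua; exact: coz_sub_gsupp.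
Qed.

(** Compact support deals with functionals supported at infinity, and vanishing
    near [F] with those supported on [F]. *)
Lemma isolating_element (F : set (Omega A)) x : tauberian A -> condition_M A ->
  finite_set F -> ~ F x ->
  exists c, [/\ gelfand c x != 0, compactly_supported c &
    forall p, F p -> ~ gsupp c p].
Proof.
move=> tA mA Ffin nFx; have [a ca ax] := compactly_supported_at x tA.
have xF : nbhs x (~` F) by apply: open_nbhs_nbhs; split => //; exact: open_setC_finite.
have [u uF] := local_unit mA xF.
exists (u * a)%g; split.
- by rewrite gelfandM (units_near_at uF) mul1r.
- by apply: compactly_supported_sub ca; rewrite bmulC => z /coz_mull/coz_sub_gsupp.
- move=> p Fp /(closure_subset (@coz_mull u a)) up.
  by case: uF => _ /(_ _ up); apply.
Qed.

End Units.

Section Functional.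
Context {R : realType} {A : commBanachAlgType R}.
Implicit Types (a b u : A) (x : Omega A) (f : {linear A -> R[i]^o}).

Definition bounded_functional f := exists M : R, forall a, cmod (f a) <= M * rnorm a.

(** For a nonzero separating functional, this is what membership of [x] in its
    support amounts to; the next definition is the same notion at infinity. *)
Definition supported_at f x := forall a, (\forall z \near x, gelfand a z = 0) -> f a = 0.

Definition supported_at_infinity f := forall a, compactly_supported a -> f a = 0.

Definition separating_functional f := forall a b, (a * b)%g = 0 -> f a * f b = 0.

(** Call an open set vanishing if [f] kills all elements with cozero set inside it.
    A point [x] without vanishing neighbourhood supports [f]: if [a] vanishes near
    [x], there is [b] with [a * b = 0] and [f b <> 0].  If instead every point has
    a vanishing neighbourhood, replacing [a] by [a - u * a], with [u] a local unit
    supported in that neighbourhood, makes [a] vanish near the point without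
    changing [f a].  Finitely many such steps, which play the part of a partition of
    unity, reduce an element of compact support to 0. *)
Lemma separating_functional_support f : semisimple A -> condition_M A ->
  separating_functional f -> (exists x, supported_at f x) \/ supported_at_infinity f.
Proof.
move=> ssA mA sepf.
have [[x fx]|nosupp] := pselect (exists x, supported_at f x); [by left; exists x|right].
have vanishing x : exists2 U, nbhs x U & forall a, coz a `<=` U -> f a = 0.
  apply: contrapT => noU; apply: nosupp; exists x => a a0.
  apply: contrapT => fa; apply: noU.
  exists [set z | gelfand a z = 0] => // b ba.
  have /sepf/eqP : (a * b)%g = 0.
    apply: semisimple_eq0 => // z; rewrite gelfandM.
    have [->|/ba ->] := eqVneq (gelfand b z) 0; by rewrite ?mulr0 ?mul0r.
  by rewrite mulf_eq0 => /orP[/eqP//|/eqP].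
(* sets on which any element can be made to vanish without changing [f]
   and without enlarging its cozero set *)
pose removable (C : set (Omega A)) := forall a, exists a', [/\ f a' = f a,
  coz a' `<=` coz a & forall z, C z -> gelfand a' z = 0].
move=> a ca; have [||x _|C CC aC] := @compact_ideal _ (gsupp a) removable _ _ _ ca.
- by move=> b; exists b; split.
- move=> C D remC remD b; have [b1 [fb1 b1b Cb1]] := remC b.
  have [b2 [fb2 b2b1 Db2]] := remD b1.
  exists b2; split; [by rewrite fb2|by move=> z /b2b1/b1b|].
  move=> z [Cz|/Db2//]; apply/eqP; apply: contrapT => /negP/b2b1.
  by rewrite /coz /= Cb1// eqxx.
- have [U xU fU] := vanishing x; have [u uU] := local_unit mA xU.
  have [[V xV u1] uU'] := uU.
  exists V => // b; exists (b - (u * b)%g); split.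
  + rewrite linearB (fU (u * b)%g) ?subr0// => z /coz_mull/coz_sub_gsupp; exact: uU'.
  + move=> z; rewrite /coz /= gelfandB gelfandM; apply: contra => /eqP ->.
    by rewrite mulr0 subrr.
  + by move=> z /u1 uz; rewrite gelfandB gelfandM uz mul1r subrr.
- have [a' [<- a'a Ca']] := CC a.
  rewrite (semisimple_eq0 (a := a') ssA) ?linear0// => z.
  apply/eqP; apply: contrapT => /negP a'z; move: (a'z).
  by rewrite Ca' ?eqxx//; apply/aC/coz_sub_gsupp/a'a.
Qed.

Lemma bounded_not_at_infinity f : tauberian A -> bounded_functional f ->
  supported_at_infinity f -> forall a, f a = 0.
Proof.
move=> [_ dA] [M fM] finf a; apply: (bounded_closed_graph fM) => e e0.
have [b cb ba] := dense_rnorm a dA e0; exists (a - b); first by rewrite rnormB.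
by rewrite linearB (finf b cb) subr0 subrr rnorm0.
Qed.

(** Condition (M) at work: elements vanishing near [x] are dense among those
    vanishing at [x], as [a - u * a] approximates [a]. *)
Lemma bounded_supported_at f x a : condition_M A -> bounded_functional f ->
  supported_at f x -> gelfand a x = 0 -> f a = 0.
Proof.
move=> [_ mA] [M fM] fx ax; apply: (bounded_closed_graph fM) => e e0.
have := mA x a setT ax filterT.
have /[swap] <- : (0 < e%:E)%E by rewrite lte_fin.
move=> /ereal_inf_lt[_ [u ux <-]]; rewrite lte_fin => ue.
exists (u * a)%g => //; rewrite -rnormN opprB -linearB.
by rewrite fx ?rnorm0//; exact: units_near_germ ux.
Qed.

(** At an isolated point, vanishing at the point and near it are the same thing. *)
Lemma isolated_supported_at f x a : open [set x] -> supported_at f x ->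
  gelfand a x = 0 -> f a = 0.
Proof.
move=> ox fx ax; apply: fx; apply: filterS (open_nbhs_nbhs (conj ox erefl)).
by move=> z ->.
Qed.

Lemma weighted_evaluation f x u : gelfand u x = 1 ->
  (forall a, gelfand a x = 0 -> f a = 0) -> forall a, f a = f u * gelfand a x.
Proof.
move=> ux fx a; apply/eqP; rewrite -subr_eq0; apply/eqP.
have /fx : gelfand (a - gelfand a x *: u) x = 0.
  by rewrite gelfandB gelfandZ ux mulr1 subrr.
by rewrite linearB linearZ /= [_ *: _]mulrC.
Qed.

Lemma weighted_evaluation_bounded f x (w : R[i]) :
  (forall a, f a = w * gelfand a x) -> bounded_functional f.
Proof.
move=> fw; exists (cmod w * 2) => a; rewrite fw cmodM -mulrA.
by rewrite ler_wpM2l ?rnorm_ge0// gelfand_le_norm.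
Qed.

(** Rescaling a witness of unboundedness makes it as small as desired while its
    value stays large. *)
Lemma unbounded_small f (e K : R) : ~ bounded_functional f -> 0 < e ->
  exists2 a, rnorm a <= e & K <= cmod (f a).
Proof.
move=> nb e0; have : exists a, `|K| / e * rnorm a < cmod (f a).
  apply: contrapT => H; apply: nb; exists (`|K| / e) => a.
  by rewrite leNgt; apply/negP => Ka; apply: H; exists a.
move=> [a Ka]; have a0 : 0 < rnorm a.
  rewrite lt_def rnorm_ge0 andbT; apply/eqP => /rnorm_eq0 a0.
  by move: Ka; rewrite a0 linear0 !rnorm0 mulr0 ltxx.
have t0 : 0 < e / rnorm a by rewrite divr_gt0.
have ct : cmod (e / rnorm a)%:C = e / rnorm a.
  by apply: complexI; rewrite -rnormE ger0_norm// lecR ltW.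
exists ((e / rnorm a)%:C *: a).
  by rewrite rnormZ ct divfK// lt0r_neq0.
rewrite linearZ rnormZ ct; apply: le_trans (ler_norm K) _.
rewrite mulrC mulrA ler_pdivlMr// mulrC.
by move/ltW: Ka; rewrite mulrAC ler_pdivrMr// mulrC.
Qed.

End Functional.

(** * Discontinuous functionals have finitely many support points *)

Section GlidingHump.
Context {R : realType} {A : commBanachAlgType R}.

(** Two distinct points of [S] have local units with disjoint supports, and a
    point of [S] cannot lie in both supports; so one of the two units leaves
    infinitely many points of [S] outside its support. *)
Lemma split_infinite (S O : set (Omega A)) : condition_M A -> open O ->
  infinite_set (S `&` O) ->
  exists p u, [/\ S p, units_near p O u & infinite_set (S `&` (O `\` gsupp u))].
Proof.
move=> mA oO Sinf.
have [p [Sp Op]] := infinite_setN0 Sinf.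
have [q [[Sq Oq] qp]] := infinite_setN0 (infinite_setD Sinf (finite_set1 p)).
have [U [V [[oU Up] [oV Vq] UV]]] := separate_points (fun pq => qp (esym pq)).
have [u pu] : exists u, units_near p (U `&` O) u.
  by apply: local_unit => //; apply: open_nbhs_nbhs; split => //; exact: openI.
have [v qv] : exists v, units_near q (V `&` O) v.
  by apply: local_unit => //; apply: open_nbhs_nbhs; split => //; exact: openI.
have weaken x (W : set (Omega A)) w : units_near x (W `&` O) w -> units_near x O w.
  by move=> [? wW]; split => // z /wW[].
have [fin|inf] := pselect (finite_set (S `&` (O `\` gsupp u))); last first.
  by exists p, u; split => //; exact: weaken pu.
exists q, v; split => //; first exact: weaken qv.
have : infinite_set ((S `&` O) `\` (S `&` (O `\` gsupp u))) by exact: infinite_setD.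
apply: sub_infinite_set => z [[Sz Oz] /= zu].
split => //; split => // zv.
have zu' : gsupp u z by apply: contrapT => nzu; apply: zu.
have [_ /(_ z zu')[Uz _]] := pu; have [_ /(_ z zv)[Vz _]] := qv.
by have : set0 z by rewrite -UV.
Qed.

(** The gliding hump.  From infinitely many support points, [split_infinite]
    extracts points [p n] with local units [u n] whose transforms have disjoint
    cozero sets.  Choose [c n] so small that the [u n * c n] have a sum [s], and
    with value at least [n] under the functional supported at [p n].  Near [p n]
    the transform of [s] is that of [c n], so [q s >= n] for all [n]. *)
Lemma finite_unbounded_supports (I : Type) (f : I -> {linear A -> R[i]^o}) (q : A -> R) :
  condition_M A -> (forall i a, cmod (f i a) <= q a) ->
  finite_set [set x | exists2 i, supported_at (f i) x & ~ bounded_functional (f i)].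
Proof.
move=> mA fq; set S := [set x | _].
apply: contrapT => Sinf.
(* the region still available, which must keep infinitely many points of [S] *)
pose state := {O : set (Omega A) | open O /\ infinite_set (S `&` O)}.
pose step (s s' : state) := exists p u,
  [/\ S p, units_near p (sval s) u & sval s' = sval s `\` gsupp u].
have stepP s : {s' | step s s'}.
  apply: cid; case: s => O [oO OS].
  have [p [u [Sp pu inf]]] := split_infinite mA oO OS.
  have oO' : open (O `\` gsupp u) by apply: openI => //; exact: open_setC_gsupp.
  by exists (exist _ (O `\` gsupp u) (conj oO' inf)), p, u.
have init : open [set: Omega A] /\ infinite_set (S `&` setT).
  by split; [exact: openT|rewrite setIT].
have [W [_ OS]] := dependent_choice stepP (exist _ setT init).
have /boolp.choice[h hP] n : exists pu : Omega A * A,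
    [/\ S pu.1, units_near pu.1 (sval (W n)) pu.2 &
      sval (W n.+1) = sval (W n) `\` gsupp pu.2].
  by have [p [u H]] := OS n; exists (p, u).
pose p n := (h n).1; pose u n := (h n).2.
have W_decr n d z : sval (W (n + d.+1)%N) z -> ~ gsupp (u n) z.
  elim: d => [|d IH]; first by rewrite addn1; have [_ _ ->] := hP n => -[].
  by rewrite addnS; have [_ _ ->] := hP (n + d.+1)%N => -[/IH].
have disj_lt n m z : (n < m)%N -> gelfand (u n) z = 0 \/ gelfand (u m) z = 0.
  move=> nm; have [umz|] := pselect (gsupp (u m) z); last by move/notin_gsupp; right.
  left; apply: notin_gsupp; apply: (@W_decr n (m - n.+1)%N).
  rewrite addnS -addSn subnKC//; have [_ [_ sub] _] := hP m; exact: sub.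
have disj n m z : n != m -> gelfand (u n) z = 1 -> gelfand (u m) z = 0.
  move=> nm uz; have : (n < m)%N || (m < n)%N by rewrite -neq_ltn.
  by case/orP => nm'; have [] := @disj_lt _ _ z nm' => //;
    rewrite uz => /eqP; rewrite oner_eq0.
have /boolp.choice[ic icP] n : exists ic : I * A,
    [/\ supported_at (f ic.1) (p n), rnorm (u n * ic.2)%g <= 1 * 2 ^- n &
        n%:R <= cmod (f ic.1 ic.2)].
  have [[i fi ubi] _ _] := hP n.
  have d0 : 0 < 2 ^- n / (rnorm (u n) + 1).
    by rewrite divr_gt0 ?invr_gt0 ?exprn_gt0// ltr_wpDl// rnorm_ge0.
  have [c cd nc] := unbounded_small n%:R ubi d0.
  exists (i, c); split => //=; apply: le_trans (rnormM _ _) _.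
  rewrite ler_pdivlMr ?ltr_wpDl ?rnorm_ge0// in cd.
  by have := rnorm_ge0 c; rewrite mul1r; lra.
have hump_small n : rnorm (u n * (ic n).2)%g <= 1 * 2 ^- n by have [] := icP n.
have [s sE] := geometric_series hump_small.
have s_near n z : gelfand (u n) z = 1 ->
    gelfand s z = gelfand (u n * (ic n).2)%g z.
  move=> uz; apply/eqP; rewrite -subr_eq0; apply/eqP.
  apply: (@rnorm_eps_le0 R R[i]^o) => e e0.
  have [N Ne] := @half_pow_small R (e / 4) ltac:(lra).
  pose m := maxn N n.+1.
  have sum_z : gelfand (\sum_(k < m) (u k * (ic k).2)%g) z = gelfand (u n * (ic n).2)%g z.
    rewrite -[LHS]/(evaluation z _) linear_sum /=.
    rewrite (bigD1 (Ordinal (leq_maxr N n.+1)))//= big1 ?addr0// => k kn.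
    by rewrite /evaluation gelfandM (disj n) ?mul0r// eq_sym; exact: kn.
  rewrite -sum_z -gelfandB; apply: le_trans (gelfand_le_norm _ _) _.
  have := sE m; have : (2 : R) ^- m <= 2 ^- N.
    rewrite lef_pV2 ?posrE ?exprn_gt0// ler_weXn2l ?leq_maxl// ; lra.
  lra.
have big n : n%:R <= q s.
  have [fi _ nf] := icP n; apply: le_trans nf _.
  have -> : f (ic n).1 (ic n).2 = f (ic n).1 s.
    have [_ pu _] := hP n.
    have near0 : \forall z \near p n, gelfand ((ic n).2 - s) z = 0.
      have [[V pV u1] _] := pu; apply: filterS pV => z /u1 uz.
      by rewrite gelfandB (s_near n)// gelfandM uz mul1r subrr.
    by have := fi _ near0; rewrite linearB => /eqP; rewrite subr_eq0 => /eqP.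
  exact: fq.
by have := big (Num.trunc (q s)).+1; rewrite leNgt truncnS_gt.
Qed.

End GlidingHump.

(** * Separating bijections are weighted compositions *)

Section SeparatingBijection.
Context {R : realType} {A B : commBanachAlgType R} (T : {linear A -> B}).

Definition coordinate (y : Omega B) : {linear A -> R[i]^o} := evaluation y \o T.

Lemma coordinateE y a : coordinate y a = gelfand (T a) y. Proof. by []. Qed.

Lemma coordinate_neq0 y : (forall b, exists a, T a = b) ->
  exists a, coordinate y a != 0.
Proof.
move=> surjT; have [b by0] := gelfand_nontrivial y.
by have [a ab] := surjT b; exists a; rewrite coordinateE ab.
Qed.

Lemma separating_coordinate y : separating T -> separating_functional (coordinate y).
Proof. by move=> sepT a b /sepT ab; rewrite !coordinateE -gelfandM ab gelfand0. Qed.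

Lemma bounded_coordinate_weighted y : tauberian A -> condition_M A ->
  (forall b, exists a, T a = b) -> separating T -> bounded_functional (coordinate y) ->
  exists x w, w != 0 /\ forall a, gelfand (T a) y = w * gelfand a x.
Proof.
move=> tA mA surjT sepT bd; have [a0 a0y] := coordinate_neq0 y surjT.
have [[x yx]|yoo] :=
    separating_functional_support (proj1 tA) mA (separating_coordinate y sepT).
- have [u ux] := local_unit mA (@filterT _ (nbhs x) _).
  have wE := weighted_evaluation (units_near_at ux)
    (fun a => bounded_supported_at mA bd yx).
  exists x, (coordinate y u); split => //.
  by apply: contra a0y => /eqP u0; rewrite wE u0 mul0r.
- by move: a0y; rewrite (bounded_not_at_infinity tA bd yoo) eqxx.
Qed.

Hypotheses (tA : tauberian A) (mA : condition_M A) (ssB : semisimple B)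
  (regB : regular_algebra B) (injT : injective T) (surjT : forall b, exists a, T a = b)
  (sepT : separating T).

(** The bounded coordinates are pointwise dominated by the norm of [T a], hence
    uniformly bounded; exceeding the uniform bound is an open condition on [y]. *)
Lemma unbounded_coordinates_open (y0 : Omega B) : ~ bounded_functional (coordinate y0) ->
  exists2 U, open_nbhs y0 U & forall y, U y -> ~ bounded_functional (coordinate y).
Proof.
move=> unb0.
have [||M _ MP] := @uniform_boundedness R A R[i]^o (Omega B)
  [set y | bounded_functional (coordinate y)] coordinate (fun a => 2 * rnorm (T a)).
- by move=> y.
- by move=> y a _; exact: gelfand_le_norm.
have [a aM] : exists a, M * rnorm a < cmod (coordinate y0 a).
  apply: contrapT => H; apply: unb0; exists M => a.
  by rewrite leNgt; apply/negP => aM; apply: H; exists a.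
exists [set y | M * rnorm a < cmod (coordinate y a)].
  split => //; rewrite openE => y ya.
  have d0 : 0 < cmod (coordinate y a) - M * rnorm a by rewrite subr_gt0.
  have near_y : \forall z \near y, cmod (gelfand (T a) z - gelfand (T a) y) <
      cmod (coordinate y a) - M * rnorm a.
    apply: (@gelfand_continuous _ _ (T a) y [set w | cmod (w - gelfand (T a) y) < _]).
    by apply/(@rnorm_ballP R R[i]^o); exists (cmod (coordinate y a) - M * rnorm a).
  apply: filterS near_y => z; rewrite /mkset !coordinateE => zy.
  have := @rnormD R R[i]^o (gelfand (T a) z) (gelfand (T a) y - gelfand (T a) z).
  rewrite addrC subrK (rnormB (gelfand (T a) y : R[i]^o)); lra.
by move=> y /= ya bdy; have := MP y a bdy; rewrite leNgt ya.
Qed.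

(** Automatic continuity.  The image of [a] is concentrated on characters with
    unbounded coordinate, which forces the transform of [a] itself onto the finite
    set [F] of their support points.  So [F] contains an isolated point of
    [Omega A], and there no functional can be both supported and unbounded. *)
Lemma coordinates_bounded y : bounded_functional (coordinate y).
Proof.
apply: contrapT => unb.
have [U [oU Uy] Uunb] := unbounded_coordinates_open unb.
have [b [by1 b0]] := regB oU Uy; have [a aE] := surjT b; subst b.
pose F := [set x | exists2 z, supported_at (coordinate z) x &
  ~ bounded_functional (coordinate z)].
have Ffin : finite_set F.
  apply: (@finite_unbounded_supports _ _ _ coordinate (fun c => 2 * rnorm (T c)) mA).
  by move=> z c; exact: gelfand_le_norm.
have ssA : semisimple A by case: tA.
have aF : coz a `<=` F.
  move=> x ax; apply: contrapT => nFx.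
  have [c [cx cc cF]] := isolating_element tA mA Ffin nFx.
  (* each coordinate kills [c * a], hence so does [T] *)
  suff ca0 : (c * a)%g = 0.
    have := gelfandM c a x; rewrite ca0 gelfand0 => /eqP.
    by rewrite eq_sym mulf_eq0 (negPf cx) (negPf ax).
  apply: injT; rewrite linear0; apply: (semisimple_eq0 ssB) => z.
  have [bdz|unbz] := pselect (bounded_functional (coordinate z)).
    have [t [w [_ zw]]] := bounded_coordinate_weighted tA mA surjT sepT bdz.
    rewrite zw gelfandM mulrCA -zw b0 ?mulr0// => /Uunb; exact.
  have [[p zp]|zoo] :=
      separating_functional_support ssA mA (separating_coordinate z sepT).
    have Fp : F p by exists z.
    rewrite -coordinateE; apply: zp.
    apply: filterS (vanish_near_notin_gsupp (cF p Fp)) => q cq.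
    by rewrite gelfandM cq mul0r.
  rewrite -coordinateE; apply: zoo.
  by apply: compactly_supported_sub cc => q /coz_mull/coz_sub_gsupp.
have [x ax] : exists x, coz a x.
  apply: contrapT => H; move: by1; rewrite (_ : a = 0) ?linear0 ?gelfand0.
    by move=> /eqP; rewrite eq_sym oner_eq0.
  apply: (semisimple_eq0 ssA) => x; apply/eqP; apply: contrapT => /negP ax.
  by apply: H; exists x.
have ox : open [set x].
  rewrite (_ : [set x] = coz a `&` ~` (F `\ x)).
    by apply: openI; [exact: open_coz|apply: open_setC_finite; exact: finite_setD].
  apply/seteqP; split => [z ->|z [az nz]].
    by split => // -[_ /(_ erefl)].
  by apply: contrapT => zx; apply: nz; split => //; exact: aF.
have [z zx] := aF x ax; apply.
have [u ux] := local_unit mA (@filterT _ (nbhs x) _).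
apply: weighted_evaluation_bounded.
apply: (weighted_evaluation (units_near_at ux)) => c; exact: isolated_supported_at.
Qed.

Lemma separating_bijection_weighted :
  exists (t : Omega B -> Omega A) (w : Omega B -> R[i]),
  (forall y, w y != 0) /\ forall a y, gelfand (T a) y = w y * gelfand a (t y).
Proof.
have /boolp.choice[tw twP] y : exists xw : Omega A * R[i], xw.2 != 0 /\
    forall a, gelfand (T a) y = xw.2 * gelfand a xw.1.
  have [x [w H]] := bounded_coordinate_weighted tA mA surjT sepT (@coordinates_bounded y).
  by exists (x, w).
exists (fun y => (tw y).1), (fun y => (tw y).2).
by split=> [y|a y]; [case: (twP y)|have [_ ->] := twP y].
Qed.

End SeparatingBijection.

(** * Weighted composition operators *)

Lemma le_supnorm (R : realType) (A : commBanachAlgType R) (a : A) (x : Omega A) :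
  cmod (gelfand a x) <= supnorm a.
Proof.
apply: ub_le_sup; last by exists x.
by exists (2 * rnorm a) => _ [z _ <-]; exact: gelfand_le_norm.
Qed.

Lemma open_setC_some (X : topologicalType) (x : X) : hausdorff_space X ->
  open (~` [set Some x] : set (one_point_compactification X)).
Proof.
move=> hX; have cx : closed [set x].
  exact: accessible_closed_set1 (hausdorff_accessible hX) _.
rewrite openE => -[z|] zx; rewrite /interior /nbhs /=.
  have zx' : nbhs z (~` [set x]).
    apply: open_nbhs_nbhs; split; first exact: closed_openC.
    by move=> zE; apply: zx; rewrite zE.
  by rewrite nbhs_simpl; apply: filterS zx' => z' z'x [].
exists [set x]; first by split; first exact: compact_set1.
by move=> p [[z zx' <-] [/zx']|-> ].
Qed.

Section WeightedComposition.
Context {R : realType} {A B : commBanachAlgType R} (T : {linear A -> B})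
  (t : Omega B -> Omega A) (w : Omega B -> R[i]).
Hypotheses (w_neq0 : forall y, w y != 0)
  (TE : forall a y, gelfand (T a) y = w y * gelfand a (t y)).

Lemma weighted_composition_coz a y : coz (T a) y <-> coz a (t y).
Proof. by rewrite /coz /= TE mulf_eq0 (negPf (w_neq0 y)). Qed.

Lemma weighted_composition_Omega'' : Omega'' T = [set: Omega B].
Proof.
apply/seteqP; split => // y _; split.
  have [a ay] := gelfand_nontrivial (t y).
  by exists a; apply/weighted_composition_coz.
move=> a e e0; exists (e / (cmod (w y) + 1)).
  by rewrite divr_gt0// ltr_wpDl// rnorm_ge0.
move=> b; rewrite ltr_pdivlMr ?ltr_wpDl ?rnorm_ge0// => ba.
rewrite /tau !TE -mulrBr -gelfandB cmodM.
have := le_supnorm (b - a) (t y); have := rnorm_ge0 (w y : R[i]^o).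
have := rnorm_ge0 (gelfand (b - a) (t y) : R[i]^o).
nra.
Qed.

(** The graph is closed because every coordinate is bounded and characters
    separate the points of [B]. *)
Lemma weighted_composition_continuous : semisimple B -> continuous (T : A -> B).
Proof.
move=> ssB.
have [M M0 TM] : exists2 M : R, 0 < M & forall a, rnorm (T a) <= M * rnorm a.
  apply: closed_graph => b bT; apply: (semisimple_eq0 ssB) => y.
  have yM a : cmod (coordinate T y a) <= (cmod (w y) * 2) * rnorm a.
    rewrite coordinateE TE cmodM -mulrA.
    by rewrite ler_wpM2l ?rnorm_ge0// gelfand_le_norm.
  apply: (bounded_closed_graph yM) => e e0.
  have [|a ae Tab] := bT (e / 2); first by rewrite divr_gt0.
  exists a; first lra.
  rewrite coordinateE -gelfandB; have := gelfand_le_norm (T a - b) y; lra.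
move=> a U /rnorm_ballP[e e0 eU]; apply/rnorm_ballP.
exists (e / M); first by rewrite divr_gt0.
move=> b ba; apply: eU; rewrite -linearB; apply: le_lt_trans (TM _) _.
by rewrite mulrC -ltr_pdivlMr.
Qed.

Lemma weighted_composition_inverse_separating (S : B -> A) :
  semisimple B -> injective T -> cancel S T ->
  forall b c, (b * c)%g = 0 -> (S b * S c)%g = 0.
Proof.
move=> ssB injT SK b c bc; apply: injT; rewrite linear0.
apply: (semisimple_eq0 ssB) => y; rewrite TE gelfandM.
have : gelfand (T (S b)) y * gelfand (T (S c)) y = 0.
  by rewrite !SK -gelfandM bc gelfand0.
move/eqP; rewrite !TE !mulf_eq0 (negPf (w_neq0 y)) /=.
by move=> /orP[]/eqP ->; rewrite ?mul0r ?mulr0.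
Qed.

(** No vanishing set contains [t y], since by regularity it would contain the
    cozero set of an element that is 1 at [t y]; and the complement of [t y] is
    vanishing. *)
Lemma weighted_composition_support_map y : regular_algebra A ->
  support_map T y = Some (t y).
Proof.
move=> regA; apply: xget_unique => [|p p_supp].
- move=> [V [oV Vvan] Vt].
  have oV' : open (Some @^-1` V).
    have /continuousP := @one_point_compactification_some_continuous (Omega A).
    exact.
  have [a [a1 a0]] := regA (t y) _ oV' Vt.
  have /eqP : tau T y a = 0.
    apply: Vvan => _ [z az <-]; apply: contrapT => nVz.
    by move: az; rewrite /coz /= a0 ?eqxx.
  by rewrite /tau TE a1 mulr1 (negPf (w_neq0 y)).
- apply: contrapT => pt; apply: p_supp; exists (~` [set Some (t y)]) => //; split.
    exact: open_setC_some (@Omega_hausdorff _ _).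
  move=> a az; rewrite /tau TE; have [->|at0] := eqVneq (gelfand a (t y)) 0.
    by rewrite mulr0.
  have /(_ erefl) : (~` [set Some (t y)]) (Some (t y)) by apply: az; exists (t y).
  by [].
Qed.

(** If [a] is 1 at [t y] and 0 off a neighbourhood of it, then [t] maps the cozero
    set of [T a], a neighbourhood of [y], into that neighbourhood. *)
Lemma weighted_composition_map_continuous : regular_algebra A -> continuous t.
Proof.
move=> regA y U; rewrite nbhsE => -[V [oV Vt] VU].
have [a [a1 a0]] := regA _ _ oV Vt.
have Tay : coz (T a) y by apply/weighted_composition_coz; rewrite /coz /= a1 oner_neq0.
apply: filterS (open_nbhs_nbhs (conj (open_coz (T a)) Tay)).
move=> z /weighted_composition_coz az; apply: VU; apply: contrapT => nV.
by move: az; rewrite /coz /= a0 ?eqxx.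
Qed.

(** Near [y] the weight agrees with the transform of [T u], for [u] a local unit
    at [t y]. *)
Lemma weighted_composition_weight_continuous : condition_M A ->
  continuous (w : Omega B -> R[i]^o).
Proof.
move=> mA y U wU; have [u uy] := local_unit mA (@filterT _ (nbhs (t y)) _).
have [[V tV u1] _] := uy.
have tVy : \forall z \near y, V (t z).
  exact: weighted_composition_map_continuous (proj1 mA) y V tV.
have TuU : \forall z \near y, U (gelfand (T u) z).
  apply: (@gelfand_continuous _ _ (T u) y); rewrite TE (units_near_at uy) mulr1.
  exact: wU.
by apply: filterS2 tVy TuU => z Vz; rewrite TE u1// mulr1.
Qed.

Lemma weighted_composition_support_weight y : tauberian A -> condition_M A ->
  support_weight T y = w y.
Proof.
move=> tA mA; rewrite /support_weight (weighted_composition_support_map y (proj1 mA)).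
apply: xget_unique => [|_ [a [_ [U [/nbhs_singleton Ut _ a1]]] <-]]; last first.
  by rewrite TE a1// mulr1.
have [u cu uy] := compactly_supported_unit (t y) tA mA.
exists u; last by rewrite TE (units_near_at uy) mulr1.
have [[V tV u1] _] := uy; split => //; exists V; split => //.
apply: (@precompact_subset _ _ (gsupp u)).
  by move=> z /u1 uz; apply: coz_sub_gsupp; rewrite /coz /= uz oner_neq0.
by rewrite precompact_closed//; exact: closed_closure.
Qed.

End WeightedComposition.

(** * Inverse weighted compositions and the structure theorem *)

(** Composing the two representations, evaluation at [x] is a multiple of
    evaluation at [t (s x)], so regularity does not separate these points. *)
Lemma weighted_compositions_cancel (R : realType) (A B : commBanachAlgType R)
    (T : {linear A -> B}) (S : {linear B -> A})
    (t : Omega B -> Omega A) (w : Omega B -> R[i])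
    (s : Omega A -> Omega B) (v : Omega A -> R[i]) :
  regular_algebra A -> cancel T S ->
  (forall a y, gelfand (T a) y = w y * gelfand a (t y)) ->
  (forall b x, gelfand (S b) x = v x * gelfand b (s x)) -> cancel s t.
Proof.
move=> regA TK TE SE x; apply: contrapT => tsx.
have [a [a1 a0]] := regA x (~` [set t (s x)]) (open_setC_finite (finite_set1 _))
  (fun h => tsx (esym h)).
have := SE (T a) x; rewrite TK TE a1 a0 ?mulr0; last exact.
by move/eqP; rewrite oner_eq0.
Qed.

Theorem proposition3p7 (R : realType) (A B : commBanachAlgType R)
    (T : {linear A -> B})
    (tauA : tauberian A) (mA : condition_M A)
    (ssB : semisimple B) (regB : regular_algebra B)
    (bijT : bijective T) (sepT : separating T) :
  [/\ Omega'' T = [set: Omega B],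
      continuous (T : A -> B)
    & exists S : {linear B -> A}, [/\ cancel T S, cancel S T & separating S]] /\
  (tauberian B -> condition_M B ->
   [/\ exists2 t : Omega B -> Omega A,
         forall y, support_map T y = Some (t y) & homeomorphism t,
       forall y, support_weight T y != 0,
       continuous (support_weight T : Omega B -> R[i]^o)
     & forall (a : A) (y : Omega B), exists2 x : Omega A,
         support_map T y = Some x &
         gelfand (T a) y = support_weight T y * gelfand a x]).
Proof.
have [ssA _] := tauA; have [regA _] := mA; have injT := bij_inj bijT.
have surjT b : exists a, T a = b by have [g _ gK] := bijT; exists (g b).
have [t [w [w0 TE]]] := separating_bijection_weighted tauA mA ssB regB injT surjT sepT.
have [S TK [SK sepS]] :
    exists2 S : {linear B -> A}, cancel T S & cancel S T /\ separating S.
  have [g TK gK] := bijT.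
  pose S : {linear B -> A} :=
    HB.pack g (GRing.isLinear.Build _ _ _ _ g (can2_linear TK gK)).
  exists S => //; split => // b c.
  exact: (@weighted_composition_inverse_separating _ _ _ _ _ _ w0 TE S).
split.
  split.
  - exact: weighted_composition_Omega'' w0 TE.
  - exact: weighted_composition_continuous TE ssB.
  - by exists S.
move=> tauB mB.
have injS := can_inj SK.
have surjS a : exists b, S b = a by exists (T a).
have [s [v [v0 SE]]] := separating_bijection_weighted tauB mB ssA regA injS surjS sepS.
have weightE y : support_weight T y = w y by exact: weighted_composition_support_weight.
have mapE y : support_map T y = Some (t y).
  exact: weighted_composition_support_map w0 TE _ regA.
split.
- exists t => //; split; first exact: weighted_composition_map_continuous w0 TE regA.
  exists s; split.
  + exact: weighted_compositions_cancel regB SK SE TE.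
  + exact: weighted_compositions_cancel regA TK TE SE.
  + exact: weighted_composition_map_continuous v0 SE regB.
- by move=> y; rewrite weightE.
- rewrite (_ : support_weight T = w); last exact/funext.
  exact: weighted_composition_weight_continuous w0 TE mA.
- by move=> a y; exists (t y); rewrite ?weightE.
Qed.
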